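(* Let $\Lambda$ be an artin algebra and let $(\Psi,\leq)$ be a proper pre-costratifying system of size $t$ in $\mathrm{mod}(\Lambda)$. If $\ell_\Lambda(\mathrm{ind}(\mathcal{F}(\Psi)))<\infty$, i.e. if the lengths of the indecomposable $\Lambda$-modules lying in $\mathcal{F}(\Psi)$ are uniformly bounded, then there exists a family $\mathbf{Q}=\{Q(i)\}_{i=1}^{t}$ of $\Lambda$-modules in $\mathcal{F}'(\Psi)$ such that $(\Psi,\mathbf{Q},\leq)$ is a proper costratifying system of size $t$ in $\mathrm{mod}(\Lambda)$.
   Context: $\Lambda$ is an artin $R$-algebra ($R$ a commutative artinian ring), $\mathrm{mod}(\Lambda)$ is the category of finitely generated left $\Lambda$-modules, and $[1,t]=\{1,\dots,t\}$. Classes of modules are understood to be closed under isomorphism. For a class $\mathcal{X}$ of modules, $\mathcal{F}(\mathcal{X})$ is the class of $M\in\mathrm{mod}(\Lambda)$ having a finite filtration $0=M_0\subseteq M_1\subseteq\cdots\subseteq M_s=M$ with every factor $M_{k}/M_{k-1}$ isomorphic to a module in $\mathcal{X}$ (an $\mathcal{X}$-filtration); $0\in\mathcal{F}(\mathcal{X})$. A proper pre-costratifying system $(\Psi,\leq)$ of size $t$ in $\mathrm{mod}(\Lambda)$ consists of a family $\Psi=\{\Psi(i)\}_{i=1}^t$ of $\Lambda$-modules and a linear order $\leq$ on $[1,t]$ such that: (a) $\mathrm{End}_\Lambda(\Psi(i))$ is a division ring for all $i$; (b) $\mathrm{Hom}_\Lambda(\Psi(i),\Psi(j))=0$ for $i<j$;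 (c) $\mathrm{Ext}^1_\Lambda(\Psi(i),\Psi(j))=0$ for $i<j$. A proper costratifying system $(\Psi,\mathbf{Q},\leq)$ of size $t$ in $\mathrm{mod}(\Lambda)$ consists of two families of $\Lambda$-modules $\Psi=\{\Psi(i)\}_{i=1}^t$ and $\mathbf{Q}=\{Q(i)\}_{i=1}^t$, with $Q(i)$ indecomposable for all $i$, and a linear order $\leq$ on $[1,t]$ such that: (a) $\mathrm{End}_\Lambda(\Psi(i))$ is a division ring for all $i$; (b) $\mathrm{Hom}_\Lambda(\Psi(i),\Psi(j))=0$ if $i<j$; (c) for each $i$ there is an exact sequence $0\to Z(i)\to Q(i)\to\Psi(i)\to 0$ with $Z(i)\in\mathcal{F}(\{\Psi(j):j\leq i\})$; (d) $\mathrm{Ext}^1_\Lambda(Q(i),\Psi(j))=0$ for all $i,j\in[1,t]$. Let $(\Psi,\leq)$ be a proper pre-costratifying system. An ordered $\Psi$-filtration of $X\in\mathcal{F}(\Psi)$ of length $n\ge1$ is a filtration $0=X_0\subseteq X_1\subseteq\cdots\subseteq X_n=X$ with $X_k/X_{k-1}\simeq\Psi(i_k)$ for $1\leq k\leq n$ and $i_1\leq i_2\leq\cdots\leq i_n$. Every nonzero $X\in\mathcal{F}(\Psi)$ has an ordered $\Psi$-filtration, and $i_1$ does not depend on the chosen ordered filtration; one sets $\min(X)=i_1$. The classes $\mathcal{F}'_n(\Psi)$ are defined inductively: $\mathcal{F}'_1(\Psi)=\Psi$; for $n>1$, $X\in\mathcal{F}'_n(\Psi)$ if and only if either $X\in\mathcal{F}'_{n-1}(\Psi)$,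 or $X$ admits an ordered $\Psi$-filtration of length $n$ and there is a non-split exact sequence $0\to\Psi(\min(X))\to X\to X'\to 0$ with $X'\in\mathcal{F}'_{n-1}(\Psi)$. Finally $\mathcal{F}'(\Psi)=\bigcup_{n\geq1}\mathcal{F}'_n(\Psi)$. *)

(* Defs.v *)
From HB Require Import structures.
From mathcomp Require Import all_boot all_order all_algebra.

Set Implicit Arguments.
Unset Strict Implicit.
Unset Printing Implicit Defensive.

Import GRing.Theory.
Local Open Scope ring_scope.
Local Open Scope quotient_scope.

(* Submodules are the boolean [submodClosed] predicates of MathComp; every      *)
(* Prop-valued submodule is of this form under classical logic (asbool).        *)

Section Submodule.
Variables (A : pzRingType) (M : lmodType A) (U : submodClosed M).

Record submod : predArgType := Submod {submod_val : M; _ : submod_val \in U}.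

HB.instance Definition _ := [isSub for submod_val].
HB.instance Definition _ := [Choice of submod by <:].
HB.instance Definition _ := [SubChoice_isSubLmodule of submod by <:].

End Submodule.

(* [Quotient.quot] takes a [zmodClosed] predicate, while [submodClosed]         *)
(* only bundles closure under sums and scaling.                                 *)
Section QuotientModule.
Variables (A : pzRingType) (M : lmodType A) (U : submodClosed M).

Definition submod_pred : {pred M} := fun x => x \in U.

Fact submod_pred_zmod_closed : zmod_closed submod_pred.
Proof.
split=> [|x y Ux Uy]; first exact: (rpred0 U).
by rewrite unfold_in rpredD // -scaleN1r rpredZ.
Qed.

HB.instance Definition _ := GRing.isZmodClosed.Build M submod_pred
  submod_pred_zmod_closed.

Definition lquot : Type := Quotient.quot submod_pred.

HB.instance Definition _ := GRing.Zmodule.on lquot.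

Definition lquot_proj : M -> lquot := \pi_(Quotient.quot submod_pred).

Definition lquot_scale (a : A) (x : lquot) : lquot :=
  lquot_proj (a *: repr (x : Quotient.quot submod_pred)).

Fact lquot_scaleE a x : lquot_scale a (lquot_proj x) = lquot_proj (a *: x).
Proof.
apply/eqP; rewrite -Quotient.idealrBE -scalerBr unfold_in rpredZ //.
by have := Quotient.idealrBE submod_pred
  (repr (lquot_proj x : Quotient.quot submod_pred)) x;
   rewrite reprK eqxx unfold_in => ->.
Qed.

Fact lquot_projD : {morph lquot_proj : x y / x + y}.
Proof. exact: Quotient.pi_add. Qed.

Fact lquot_projK (x : lquot) :
  lquot_proj (repr (x : Quotient.quot submod_pred)) = x.
Proof. exact: reprK. Qed.

Fact lquot_scaleA a b x : lquot_scale a (lquot_scale b x) = lquot_scale (a * b) x.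
Proof. by rewrite -[x]lquot_projK !lquot_scaleE scalerA. Qed.

Fact lquot_scale1 : left_id 1 lquot_scale.
Proof. by move=> x; rewrite -[x]lquot_projK lquot_scaleE scale1r. Qed.

Fact lquot_scaleDr : right_distributive lquot_scale +%R.
Proof.
move=> a x y; rewrite -[x]lquot_projK -[y]lquot_projK.
by rewrite -lquot_projD !lquot_scaleE -lquot_projD scalerDr.
Qed.

Fact lquot_scaleDl x : {morph lquot_scale^~ x : a b / a + b}.
Proof.
move=> a b; rewrite -[x]lquot_projK !lquot_scaleE -lquot_projD.
by rewrite scalerDl.
Qed.

HB.instance Definition _ := GRing.Zmodule_isLmodule.Build A lquot
  lquot_scaleA lquot_scale1 lquot_scaleDr lquot_scaleDl.

End QuotientModule.

(* For submodules W <= U of M, [factor U W] is U / W, the quotient of the       *)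
(* module U by its submodule {x : U | x \in W}.                                 *)
Section Factor.
Variables (A : pzRingType) (M : lmodType A) (U W : submodClosed M).

Definition restr_pred : {pred submod U} := fun x => submod_val x \in W.

Fact restr_pred_submod_closed : submod_closed restr_pred.
Proof.
split=> [|a x y Wx Wy]; first exact: (rpred0 W).
by rewrite unfold_in /= rpredD // rpredZ.
Qed.

HB.instance Definition _ := GRing.isSubmodClosed.Build A (submod U) restr_pred
  restr_pred_submod_closed.

Definition factor : lmodType A := lquot restr_pred.

End Factor.

Section Modules.
Variable A : pzRingType.
Implicit Types M N E : lmodType A.

Definition is_zero M := forall x : M, x = 0.

Definition lmod_iso M N := exists f : {linear M -> N}, bijective f.

Definition fingen M := exists (n : nat) (s : 'I_n -> M),
  forall x, exists c : 'I_n -> A, x = \sum_i c i *: s i.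

Definition artinian M := forall I : nat -> submodClosed M,
  (forall n, {subset I n.+1 <= I n}) ->
  exists n, forall m, (n <= m)%N -> I m =i I n.

Definition simple_mod M :=
  ~ is_zero M /\ forall U : submodClosed M, U =i pred1 0 \/ U =i predT.

Definition indecomposable M := ~ is_zero M /\
  forall N1 N2, lmod_iso M (N1 * N2)%type -> is_zero N1 \/ is_zero N2.

Definition Hom_eq0 M N := forall (f : {linear M -> N}) x, f x = 0.

(* 1 <> 0 in End(M) means that M is nonzero. *)
Definition End_division M := ~ is_zero M /\
  forall f : {linear M -> M}, ~ (forall x, f x = 0) ->
  exists g : {linear M -> M}, cancel f g /\ cancel g f.

Definition short_exact N E M (f : {linear N -> E}) (g : {linear E -> M}) :=
  [/\ injective f, forall y, exists x, g x = y
    & forall y, g y = 0 <-> exists x, f x = y].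

Definition split_epi E M (g : {linear E -> M}) :=
  exists s : {linear M -> E}, cancel s g.

(* Yoneda's Ext^1(M, N): equivalence classes of the extensions of M by N.       *)
Record extension M N := Extension {
  ext_mod : lmodType A;
  ext_in : {linear N -> ext_mod};
  ext_out : {linear ext_mod -> M};
  ext_exact : short_exact ext_in ext_out
}.

(* By the five lemma h is automatically bijective. *)
Definition ext_equiv M N (X Y : extension M N) :=
  exists h : {linear ext_mod X -> ext_mod Y},
    (forall x, h (ext_in X x) = ext_in Y x) /\
    (forall x, ext_out Y (h x) = ext_out X x).

(* Ext^1(M, N) always contains the class of the split extension, so it is zero  *)
(* when it has a single class.                                                  *)
Definition Ext1_eq0 M N := forall X Y : extension M N, ext_equiv X Y.

(* 0 = U 0 <= U 1 <= ... <= U n = M with U (k+1) / U k satisfying P k for k < n; *)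
(* the values U k with k > n are irrelevant. *)
Definition filtration M (n : nat) (P : nat -> lmodType A -> Prop)
    (U : nat -> submodClosed M) :=
  [/\ U 0%N =i pred1 0, U n =i predT,
      forall k, (k < n)%N -> {subset U k <= U k.+1}
    & forall k, (k < n)%N -> P k (factor (U k.+1) (U k))].

Definition has_length M n :=
  exists U, @filtration M n (fun=> simple_mod) U.

End Modules.

Record fgMod (A : pzRingType) := FgMod {
  fg_sort :> lmodType A;
  fg_fingen : fingen fg_sort
}.

Definition artinian_ring (R : pzRingType) := artinian (R^o : lmodType R).

Definition artin_algebra (R : comPzRingType) (A : algType R) :=
  artinian_ring R /\ fingen (A : lmodType R).

Definition linear_order (T : Type) (le : rel T) :=
  [/\ reflexive le, antisymmetric le, transitive le & total le].

Section Systems.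
Variables (A : pzRingType) (t : nat).
Implicit Types (X Y : fgMod A) (C : fgMod A -> Prop).

Definition Filt C X := exists n U,
  @filtration A X n (fun _ N => exists2 Y, C Y & lmod_iso N Y) U.

Variables (le : rel 'I_t) (Psi : 'I_t -> fgMod A).

Definition idx_lt (i j : 'I_t) := (i != j) && le i j.

Definition proper_pre_costratifying :=
  [/\ linear_order le,
      forall i, End_division (Psi i),
      forall i j, idx_lt i j -> Hom_eq0 (Psi i) (Psi j)
    & forall i j, idx_lt i j -> Ext1_eq0 (Psi i) (Psi j)].

Definition proper_costratifying (Q : 'I_t -> fgMod A) :=
  [/\ linear_order le /\ forall i, indecomposable (Q i),
      forall i, End_division (Psi i),
      forall i j, idx_lt i j -> Hom_eq0 (Psi i) (Psi j),
      forall i, exists (Z : fgMod A) (f : {linear Z -> Q i})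
          (g : {linear Q i -> Psi i}),
        Filt (fun Y => exists2 j, le j i & Y = Psi j) Z /\ short_exact f g
    & forall i j, Ext1_eq0 (Q i) (Psi j)].

Definition FiltPsi := Filt (fun Y => exists j, Y = Psi j).

Definition ordered_filtration X (n : nat) (i : nat -> 'I_t)
    (U : nat -> submodClosed X) :=
  (forall k, (k.+1 < n)%N -> le (i k) (i k.+1)) /\
  filtration n (fun k N => lmod_iso N (Psi (i k))) U.

(* min(X) = m, as a relation: m is the first index of an ordered filtration of  *)
(* positive length. *)
Definition is_min X (m : 'I_t) := exists n i U,
  [/\ (0 < n)%N, @ordered_filtration X n i U & i 0%N = m].

(* F'_n for n >= 1; the value at n = 0 is a dummy. *)
Fixpoint Fprime_n (n : nat) X : Prop :=
  match n with
  | 0 => False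
  | n'.+1 =>
    match n' with
    | 0 => exists i, lmod_iso X (Psi i)
    | _.+1 =>
      Fprime_n n' X \/
      (exists i U, @ordered_filtration X n i U) /\
      exists (m : 'I_t) (X' : fgMod A)
          (f : {linear Psi m -> X}) (g : {linear X -> X'}),
        [/\ is_min X m, Fprime_n n' X', short_exact f g & ~ split_epi g]
    end
  end.

Definition Fprime X := exists2 n, (0 < n)%N & Fprime_n n X.

Definition bounded_ind_length := exists N : nat, forall X,
  FiltPsi X -> indecomposable X -> exists2 n, has_length X n & (n <= N)%N.

End Systems.

(* Main.v *)
Require Import Defs.
From HB Require Import structures.
From mathcomp Require Import all_boot all_order all_algebra.
From mathcomp Require Import boolp.

(** Start from [Psi i] and stack copies of the [Psi j] with [j <= i] under it,
    in decreasing order of [j]: as long as the module [M] built so far has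
    [Ext1 M (Psi j) <> 0], replace it by the middle term of a non-split
    extension [0 -> Psi j -> M' -> M -> 0]; once [Ext1 M (Psi j) = 0], pass to
    the predecessor of [j].  The modules so reached are the towers on [Psi i].
    A tower is in F'(Psi), because the indices met from the bottom upwards are
    non-decreasing, and the kernel of the composite map onto [Psi i] is filtered
    by the [Psi j] with [j <= i].

    Work done for larger indices is never undone: for [j < k] the end terms of
    [Ext1 M (Psi k) -> Ext1 M' (Psi k) -> Ext1 (Psi j) (Psi k)] vanish if
    [Ext1 M (Psi k)] does ([Ext1_eq0_ext]).  So the procedure ends with
    [Ext1 M (Psi k) = 0] for all [k], provided that every index [j] is exhausted
    after finitely many steps.

    That is where the bound on lengths enters.  A tower with [n] factors
    [Psi k] has length at least [n] ([filtration_le_length]), so it is enough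
    that towers be indecomposable.  Fix [j] and let [N] be the tower at which
    the index [j] starts, so that [N] has only trivial idempotents; let
    [p : M -> N] be the projection of a later stage [M].  Since [End (Psi j)] is
    a division ring, a map [M' -> Psi j] that is nonzero on the bottom copy of
    [Psi j] would split the extension; hence all maps [M -> Psi j] kill [ker p].
    So do all maps [M -> N], since [Hom (Psi j) N = 0], unless [N = Psi j] is
    the starting point and the two assertions coincide.  An idempotent [e] of
    [M] therefore induces an idempotent of [N], and after exchanging [e] with
    [1 - e] it has its image in [ker p].  If [e] were nonzero, the filtration of
    [ker p] by copies of [Psi j] would yield a nonzero map [h : M -> Psi j] with
    [h = h e]; but [h] kills [ker p], which contains the image of [e].  So
    [e = 0] ([invisible_ker_idem_trivial]). *)

Set Implicit Arguments.
Unset Strict Implicit.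
Unset Printing Implicit Defensive.

Import GRing.Theory.
Local Open Scope ring_scope.

(** * Linear maps, split sequences and Ext1 *)

Section LinearAlgebra.
Variable A : pzRingType.
Implicit Types M N E C W Y : lmodType A.

Lemma linear_map M C (h : M -> C) : linear h ->
  exists h' : {linear M -> C}, h' =1 h.
Proof.
move=> h_lin; pose L := GRing.isLinear.Build A M C *:%R h h_lin.
pose h' : {linear M -> C} := HB.pack h L.
by exists h'.
Qed.

Lemma lift_epi E M C (g : {linear E -> M}) (h : {linear E -> C}) :
  (forall y, exists x, g x = y) -> (forall x, g x = 0 -> h x = 0) ->
  exists h' : {linear M -> C}, forall x, h' (g x) = h x.
Proof.
move=> g_surj ker_gh.
have g_surjb y : exists x, g x == y by have [x <-] := g_surj y; exists x.
pose u y := xchoose (g_surjb y).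
have gu y : g (u y) = y by apply/eqP/(xchooseP (g_surjb y)).
have h_eq x x' : g x = g x' -> h x = h x'.
  move=> gxx'; apply/eqP; rewrite -subr_eq0 -linearB /=.
  by apply/eqP/ker_gh; rewrite linearB /= gxx' subrr.
have [|h' h'E] := @linear_map M C (h \o u).
  move=> a x y /=; rewrite -linearP; apply: h_eq.
  by rewrite linearP !gu.
by exists h' => x; rewrite h'E; apply: h_eq; rewrite gu.
Qed.

Lemma lift_mono Y E W (f : {linear Y -> E}) (e : {linear W -> E}) :
  injective f -> (forall x, exists y, f y = e x) ->
  exists h : {linear W -> Y}, forall x, f (h x) = e x.
Proof.
move=> f_inj im_ef.
have im_efb x : exists y, f y == e x by have [y <-] := im_ef x; exists y.
pose u x := xchoose (im_efb x).
have fu x : f (u x) = e x by apply/eqP/(xchooseP (im_efb x)).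
have [|h hE] := @linear_map W Y u.
  by move=> a x y; apply: f_inj; rewrite linearP !fu linearP.
by exists h => x; rewrite hE.
Qed.

Lemma linear_bijective M N (f : {linear M -> N}) :
  (forall x, f x = 0 -> x = 0) -> (forall y, exists x, f x = y) -> bijective f.
Proof.
move=> f_inj f_surj.
have f_surjb y : exists x, f x == y by have [x <-] := f_surj y; exists x.
have fu y : f (xchoose (f_surjb y)) = y by apply/eqP/(xchooseP (f_surjb y)).
exists (fun y => xchoose (f_surjb y)) => // x.
by apply/eqP; rewrite -subr_eq0; apply/eqP/f_inj; rewrite linearB /= fu subrr.
Qed.

Lemma lmod_iso_refl M : lmod_iso M M.
Proof. by exists idfun; exists id. Qed.

Lemma lmod_iso_trans M N E : lmod_iso M N -> lmod_iso N E -> lmod_iso M E.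
Proof.
by move=> [f f_bij] [g g_bij]; exists (g \o f)%FUN; apply: bij_comp.
Qed.

Lemma retraction_split N E M (f : {linear N -> E}) (g : {linear E -> M})
  (r : {linear E -> N}) : short_exact f g -> cancel f r -> split_epi g.
Proof.
move=> [_ g_surj g_ker] fK.
have [|s sE] := lift_epi (h := idfun \- (f \o r))%FUN g_surj.
  by move=> x /g_ker[y <-] /=; rewrite fK subrr.
exists s => y; have [x <-] := g_surj y; rewrite sE /= linearB /=.
suff -> : g (f (r x)) = 0 by rewrite subr0.
by apply/g_ker; exists (r x).
Qed.

Lemma split_retraction N E M (f : {linear N -> E}) (g : {linear E -> M}) :
  short_exact f g -> split_epi g -> exists r : {linear E -> N}, cancel f r.
Proof.
move=> [f_inj g_surj g_ker] [s sK].
have [|r rE] := lift_mono (e := idfun \- (s \o g))%FUN f_inj.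
  by move=> x; apply/g_ker; rewrite /= linearB /= sK subrr.
exists r => x; apply: f_inj; rewrite rE /=.
suff -> : g (f x) = 0 by rewrite linear0 subr0.
by apply/g_ker; exists x.
Qed.

(** Splitting is what the rest of the proof manipulates; the comparison of
    arbitrary pairs of extensions reduces to it because two split extensions are
    both equivalent to the direct sum. *)
Lemma Ext1_eq0P M N :
  Ext1_eq0 M N <->
  forall E (f : {linear N -> E}) (g : {linear E -> M}),
    short_exact f g -> split_epi g.
Proof.
split=> [Ext0 E f g fg | splitP X Y].
  have [|i iE] := @linear_map N (N * M)%type (fun x => (x, 0)).
    by move=> a x y; congr pair; rewrite /= scaler0 addr0.
  have [|p pE] := @linear_map (N * M)%type M snd; first by [].
  have ip : short_exact i p.
    split=> [x y|y|[x y]]; first by rewrite !iE => -[].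
      by exists (0, y); rewrite pE.
    rewrite pE; split=> [/= ->|[z]]; first by exists x; rewrite iE.
    by rewrite iE => -[_ <-].
  have [h [hi _]] := Ext0 (Extension fg) (Extension ip).
  have [|r rE] := @linear_map E N (fst \o h).
    by move=> a x y /=; rewrite linearP.
  apply: (retraction_split (r := r) fg) => x.
  by rewrite rE /= hi /= iE.
have [rX rXK] := split_retraction (ext_exact X) (splitP _ _ _ (ext_exact X)).
have [sY sYK] := splitP _ _ _ (ext_exact Y).
have [_ _ gX] := ext_exact X; have [_ _ gY] := ext_exact Y.
exists ((ext_in Y \o rX) \+ (sY \o ext_out X))%FUN; split=> x /=.
  rewrite rXK; suff -> : ext_out X (ext_in X x) = 0 by rewrite linear0 addr0.
  by apply/gX; exists x.
rewrite linearD /= sYK; suff -> : ext_out Y (ext_in Y (rX x)) = 0.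
  by rewrite add0r.
by apply/gY; exists (rX x).
Qed.

End LinearAlgebra.

(** * Submodules, quotients and factors *)

Section Submodules.
Variable A : pzRingType.
Implicit Types M N E C W X Y : lmodType A.

Section Instances.
Variables (M : lmodType A).

Fact pred1_0_submod_closed : submod_closed (pred1 0 : {pred M}).
Proof.
split=> [|a x y]; rewrite !inE // => /eqP-> /eqP->.
by rewrite scaler0 addr0.
Qed.
HB.instance Definition _ :=
  GRing.isSubmodClosed.Build A M (pred1 0) pred1_0_submod_closed.
Definition zero_submod : submodClosed M := pred1 0.

Variables (N : lmodType A) (g : {linear M -> N}) (V : submodClosed N).
Definition preim_pred : {pred M} := fun x => g x \in V.
Fact preim_submod_closed : submod_closed preim_pred.
Proof.
split=> [|a x y gx gy]; first by rewrite unfold_in linear0 rpred0.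
by rewrite unfold_in linearP rpredD // rpredZ.
Qed.
HB.instance Definition _ :=
  GRing.isSubmodClosed.Build A M preim_pred preim_submod_closed.
Definition preim_submod : submodClosed M := preim_pred.

Definition range_pred : {pred N} := fun y => `[< exists x, g x = y >].
Fact range_submod_closed : submod_closed range_pred.
Proof.
split=> [|a x y]; first by apply/asboolP; exists 0; rewrite linear0.
move=> /asboolP[u <-] /asboolP[v <-]; apply/asboolP.
by exists (a *: u + v); rewrite linearP.
Qed.
HB.instance Definition _ :=
  GRing.isSubmodClosed.Build A N range_pred range_submod_closed.
Definition range_submod : submodClosed N := range_pred.

End Instances.

Lemma mem_preim M N (g : {linear M -> N}) (V : submodClosed N) x :
  (x \in preim_submod g V) = (g x \in V).
Proof. by []. Qed.

Section QuotientProjection.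
Variables (M : lmodType A) (U : submodClosed M).

Lemma lquot_proj_linear : linear (@lquot_proj A M U).
Proof.
by move=> a x y; rewrite lquot_projD -lquot_scaleE.
Qed.
HB.instance Definition _ :=
  GRing.isLinear.Build A M (lquot U) *:%R (@lquot_proj A M U) lquot_proj_linear.

Lemma lquot_proj_surj (y : lquot U) : exists x, lquot_proj U x = y.
Proof.
by exists (repr (y : Quotient.quot (submod_pred U))); apply: lquot_projK.
Qed.

Lemma lquot_proj_eq0 x : lquot_proj U x = 0 <-> x \in U.
Proof.
have -> : (x \in U) = (lquot_proj U x == lquot_proj U 0).
  rewrite -Quotient.idealrBE subr0; by rewrite unfold_in.
by rewrite linear0; split=> [/eqP|/eqP].
Qed.

End QuotientProjection.

Lemma submod_val_linear M (U : submodClosed M) : linear (@submod_val A M U).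
Proof. by []. Qed.
HB.instance Definition _ M (U : submodClosed M) :=
  GRing.isLinear.Build A (submod U) M *:%R (@submod_val A M U)
    (submod_val_linear (U := U)).

Lemma submod_val_inj M (U : submodClosed M) : injective (@submod_val A M U).
Proof. exact: val_inj. Qed.

Lemma lquot_iso M N (U : submodClosed M) (g : {linear M -> N}) :
  (forall y, exists x, g x = y) -> (forall x, g x = 0 <-> x \in U) ->
  lmod_iso (lquot U) N.
Proof.
move=> g_surj g_ker.
have [|h hE] := lift_epi (g := @lquot_proj A M U) (h := g)
  (@lquot_proj_surj M U).
  by move=> x /lquot_proj_eq0/g_ker.
exists h; apply: linear_bijective => [z|y].
  have [x <-] := lquot_proj_surj z.
  by rewrite hE => /g_ker/lquot_proj_eq0.
by have [x <-] := g_surj y; exists (lquot_proj U x); rewrite hE.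
Qed.

Lemma mem_restr M (U W : submodClosed M) (x : submod U) :
  (x \in restr_pred (U := U) W) = (submod_val x \in W).
Proof. by []. Qed.

(** The third isomorphism theorem, needed to pull a filtration of a quotient
    back to the module. *)
Lemma factor_preim_iso M N (g : {linear M -> N}) (U W : submodClosed N) :
  (forall y, exists x, g x = y) ->
  lmod_iso (factor (preim_submod g U) (preim_submod g W)) (factor U W).
Proof.
move=> g_surj.
have [|g' g'E] := lift_mono (f := @submod_val A N U)
  (e := g \o @submod_val A M (preim_submod g U)) (@submod_val_inj N U).
  by case=> x gx; exists (Submod (gx : g x \in U)).
have [|h hE] := @linear_map A _ _
  (fun x => lquot_proj (restr_pred (U := U) W) (g' x)).
  by move=> a x y /=; rewrite !linearP.
apply: (lquot_iso (g := h)) => [z|x].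
  have [[y Uy] <-] := lquot_proj_surj z; have [x gx] := g_surj y.
  have Ux : x \in preim_submod g U by rewrite mem_preim gx.
  exists (Submod Ux); rewrite hE; congr lquot_proj.
  by apply/val_inj; rewrite g'E.
by rewrite hE lquot_proj_eq0 !mem_restr g'E.
Qed.

(** The bottom step of a pulled back filtration is the kernel of [g], that is,
    the left end of the exact sequence. *)
Lemma factor_ker_iso Y X X' (f : {linear Y -> X}) (g : {linear X -> X'})
  (U : submodClosed X') (W : submodClosed X) :
  short_exact f g -> U =i pred1 0 -> W =i pred1 0 ->
  lmod_iso (factor (preim_submod g U) W) Y.
Proof.
move=> [f_inj g_surj g_ker] U0 W0.
have [|h hE] := lift_mono (f := f)
  (e := @submod_val A X (preim_submod g U)) f_inj.
  by case=> x gx; apply/g_ker/eqP; rewrite -[_ == 0]U0.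
apply: (lquot_iso (g := h)) => [y|x].
  have Ufy : f y \in preim_submod g U.
    by rewrite mem_preim U0 inE; apply/eqP/g_ker; exists y.
  by exists (Submod Ufy); apply: f_inj; rewrite hE.
rewrite mem_restr W0 inE -hE; split=> [->|].
  by rewrite linear0.
by move/eqP; rewrite -[X in _ = X](linear0 f) => /f_inj.
Qed.

(** * Filtrations, generators and Ext1 along an extension *)

(** Stated for step-dependent conditions [P] and [P'], shifted by one against
    each other, so that it covers both membership in a filtered class and
    filtrations with a prescribed sequence of indices. *)
Lemma filtration_ext (P P' : nat -> lmodType A -> Prop) n Y X X'
  (f : {linear Y -> X}) (g : {linear X -> X'}) V :
  short_exact f g -> filtration (M := X') n P V ->
  (forall N, lmod_iso N Y -> P' 0%N N) ->
  (forall k N N', lmod_iso N N' -> P k N' -> P' k.+1 N) ->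
  exists U, filtration (M := X) n.+1 P' U.
Proof.
move=> fg [V0 Vn V_inc PV] P'0 P'S; have [f_inj g_surj g_ker] := fg.
pose U k := if k is k'.+1 then preim_submod g (V k') else zero_submod X.
exists U; split=> //.
- by move=> x; rewrite mem_preim Vn.
- move=> [|k] kn x; last by rewrite !mem_preim; apply: V_inc.
  by rewrite inE => /eqP->; rewrite rpred0.
- move=> [|k] kn; first by apply/P'0/(factor_ker_iso fg).
  by apply: P'S (PV k kn); apply: factor_preim_iso.
Qed.

Lemma fingen_ext Y X X' (f : {linear Y -> X}) (g : {linear X -> X'}) :
  short_exact f g -> fingen Y -> fingen X' -> fingen X.
Proof.
move=> [_ g_surj g_ker] [m [s sP]] [n [s' s'P]].
have [u uE] := choice (fun i => g_surj (s' i)).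
exists (m + n)%N.
exists (fun k => match split k with inl i => f (s i) | inr j => u j end).
move=> x; have [c' c'E] := s'P (g x).
have /g_ker[y fy] : g (x - \sum_i c' i *: u i) = 0.
  rewrite linearB linear_sum /= c'E; apply/eqP; rewrite subr_eq0; apply/eqP.
  by apply: eq_bigr => i _; rewrite linearZ /= uE.
have [c cE] := sP y.
exists (fun k => match split k with inl i => c i | inr j => c' j end).
rewrite big_split_ord /=; apply/eqP; rewrite -subr_eq; apply/eqP.
under [X in x - X]eq_bigr => i _.
  rewrite (unsplitK (inr i : 'I_m + 'I_n)%type); over.
under [RHS]eq_bigr => i _.
  rewrite (unsplitK (inl i : 'I_m + 'I_n)%type); over.
by rewrite -fy cE linear_sum; apply: eq_bigr => i _; rewrite linearZ.
Qed.

(** Exactness of [Ext1 X' C -> Ext1 X C -> Ext1 Y C], done by hand on an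
    extension [0 -> C -> E -> X -> 0].  Its restriction to [Y] splits, which
    embeds [Y] in [E]; the quotient of [E] by this copy of [Y] is an extension
    of [X'] by [C], and a retraction of that one onto [C] also retracts [E]. *)
Lemma Ext1_eq0_ext Y X X' C (f : {linear Y -> X}) (g : {linear X -> X'}) :
  short_exact f g -> Ext1_eq0 X' C -> Ext1_eq0 Y C -> Ext1_eq0 X C.
Proof.
move=> fg /Ext1_eq0P ExtX' /Ext1_eq0P ExtY; have [f_inj g_surj g_ker] := fg.
apply/Ext1_eq0P => E a b ab; have [a_inj b_surj b_ker] := ab.
pose gb : {linear E -> X'} := g \o b.
have ba c : b (a c) = 0 by apply/b_ker; exists c.
pose EY := preim_submod gb (zero_submod X').
have EYP x : reflect (g (b x) = 0) (x \in EY) by apply: eqP.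
have [|aY aYE] := lift_mono (f := @submod_val A E EY) (e := a)
  (@submod_val_inj _ _).
  move=> c; have /EYP EYc : g (b (a c)) = 0 by rewrite ba linear0.
  by exists (Submod EYc).
have [|bY bYE] := lift_mono (f := f) (e := b \o @submod_val A E EY) f_inj.
  by case=> x EYx; apply/g_ker/EYP.
have abY : short_exact aY bY.
  split=> [c c' aYc|y|[x EYx]].
  - by apply: a_inj; rewrite -!aYE aYc.
  - have [x bx] := b_surj (f y).
    have /EYP EYx : g (b x) = 0 by rewrite bx; apply/g_ker; exists y.
    by exists (Submod EYx); apply: f_inj; rewrite bYE.
  - split=> [bY0|[c <-]].
      have := bYE (Submod EYx); rewrite bY0 linear0 => /esym/b_ker[c ac].
      by exists c; apply: val_inj; rewrite /= aYE.
    by apply: f_inj; rewrite bYE linear0 /= aYE.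
have [s sK] := ExtY _ _ _ abY.
have bs y : b (submod_val (s y)) = f y by rewrite -{2}[y]sK bYE.
pose s' : {linear Y -> E} := @submod_val A E EY \o s.
pose S := range_submod s'.
have SP x : x \in S <-> exists y, s' y = x.
by split=> [/asboolP|?]; last apply/asboolP.
pose pr := @lquot_proj A E S : {linear _ -> _}.
have [|bS bSE] := lift_epi (g := pr) (h := gb) (@lquot_proj_surj _ _).
  by move=> x /lquot_proj_eq0/SP[y <-]; rewrite /= bs; apply/g_ker; exists y.
pose aS : {linear C -> lquot S} := pr \o a.
have abS : short_exact aS bS.
  split=> [c c' /= /eqP|z|z].
  - rewrite -subr_eq0 -!linearB => /eqP /lquot_proj_eq0/SP[y s'y].
    apply/eqP; rewrite -subr_eq0; apply/eqP/a_inj; rewrite linear0 -s'y.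
    suff -> : y = 0 by rewrite linear0.
    by apply: f_inj; rewrite -bs [submod_val _]s'y ba linear0.
  - have [x <-] := g_surj z; have [e <-] := b_surj x.
    by exists (pr e); rewrite bSE.
  - split=> [|[c <-]]; last first.
      by rewrite [aS c]/(pr (a c)) bSE /= ba linear0.
    have [e <-] : exists e, pr e = z by apply: lquot_proj_surj.
    rewrite bSE => /g_ker[y]; rewrite -bs => /eqP.
    rewrite eq_sym -subr_eq0 -linearB => /eqP/b_ker[c ac].
    exists c; change (pr (a c) = pr e); rewrite ac linearB /=.
    suff /lquot_proj_eq0 -> : submod_val (s y) \in S by rewrite subr0.
    by apply/SP; exists y.
have [r rK] := split_retraction abS (ExtX' _ _ _ abS).
by apply: (retraction_split (r := r \o pr) ab) => c /=; apply: rK.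
Qed.

End Submodules.

(** * Filtrations are no longer than composition series *)

Section Length.
Variables (A : pzRingType) (X : lmodType A).
Variables (n : nat) (U : nat -> submodClosed X).
Hypothesis U_series : filtration n (fun=> @simple_mod A) U.

(** The steps of the composition series at which the trace of [V] grows; their
    number is the length of [V]. *)
Definition jumps (V : submodClosed X) : {set 'I_n} :=
  [set k : 'I_n | `[< exists x, [/\ x \in V, x \in U k.+1 & x \notin U k] >]].

(** Strict monotonicity of the length.  If the trace of [W] grows at step [k],
    so does that of [V], which by simplicity then covers the whole factor; an
    element of [W] in [U k.+1] is thus congruent to one of [V] modulo [U k], and
    their difference lies in [W] and one step lower. *)
Lemma jumps_subset (V W : submodClosed X) :
  {subset V <= W} -> jumps W \subset jumps V -> {subset W <= V}.
Proof.
have [U0 Un U_inc U_simple] := U_series.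
move=> VW /subsetP jWV x Wx; have : x \in U n by rewrite Un.
move: {-2}n (leqnn n) x Wx; elim=> [_ x _|k IHk kn x Wx Ux].
  by rewrite U0 inE => /eqP->; rewrite rpred0.
have [Ukx|Ukx] := boolP (x \in U k); first exact: IHk (ltnW kn) x Wx Ukx.
have /jWV : Ordinal kn \in jumps W by rewrite inE; apply/asboolP; exists x.
rewrite inE => /asboolP[v [Vv Uv /negP Ukv]].
have [_ simpleU] := U_simple k kn.
(* T is the image of the trace of V in the simple factor. *)
pose p : {linear submod (U k.+1) -> factor (U k.+1) (U k)} :=
  @lquot_proj A _ (restr_pred (U := U k.+1) (U k)).
have pE y : p y = 0 <-> submod_val y \in U k by apply: lquot_proj_eq0.
pose VU := preim_submod (@submod_val A X (U k.+1)) V.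
pose T := range_submod (p \o @submod_val A _ VU)%FUN.
have T_im y : submod_val y \in V -> p y \in T.
  by move=> Vy; apply/asboolP; exists (Submod (Vy : y \in VU)).
have [T0|T1] := simpleU T.
  have := T_im (Submod Uv) Vv; rewrite T0 inE => /eqP/pE Ukv'.
  by case: Ukv.
have : p (Submod Ux) \in T by rewrite T1.
move=> /asboolP[[y Vy] /eqP]; rewrite eq_sym -subr_eq0 -linearB => /eqP/pE Ukxy.
rewrite -[x](subrK (submod_val y)) rpredD //; apply: IHk (ltnW kn) _ _ Ukxy.
by rewrite -scaleN1r rpredD // rpredZ // VW.
Qed.

End Length.

Lemma filtration_le_length (A : pzRingType) (X : lmodType A) n m P V :
  has_length X n -> filtration (M := X) m P V ->
  (forall k N, P k N -> ~ is_zero N) -> (m <= n)%N.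
Proof.
move=> [U serU] [_ _ V_inc PV] P_neq0.
suff le_jumps k : (k <= m)%N -> (k <= #|jumps n U (V k)|)%N.
  apply: leq_trans (le_jumps m (leqnn m)) _.
  by rewrite -[leqRHS]card_ord max_card.
elim: k => // k IHk km; apply: leq_ltn_trans (IHk (ltnW km)) _.
apply: proper_card; rewrite properE; apply/andP; split.
  apply/subsetP => l; rewrite !inE => /asboolP[x [Vx Ux Ulx]].
  by apply/asboolP; exists x; split=> //; apply: V_inc.
apply/negP => /(jumps_subset serU (V_inc k km)) VS.
apply: (P_neq0 _ _ (PV k km)) => y; have [[x Vx] <-] := lquot_proj_surj y.
by apply/lquot_proj_eq0; apply: VS.
Qed.

(** * Indecomposability of iterated non-split extensions *)

Section Idempotents.
Variable A : pzRingType.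
Implicit Types M N E C W X Y : lmodType A.

(** Indecomposability in the form that passes along extensions. *)
Definition idem_trivial M := ~ is_zero M /\
  forall e : {linear M -> M}, (forall x, e (e x) = e x) ->
    (forall x, e x = 0) \/ (forall x, e x = x).

Lemma idem_trivial_indecomposable M : idem_trivial M -> indecomposable M.
Proof.
move=> [M0 idemM]; split=> // N1 N2 [f [f' fK f'K]].
have f'_lin : linear f'.
  by move=> a x y; apply: (can_inj fK); rewrite f'K linearP !f'K.
have [|e eE] := @linear_map A M M (fun x => f' ((f x).1, 0)).
  move=> a x y /=; rewrite -f'_lin linearP; congr f'.
  by congr pair; rewrite /= scaler0 addr0.
case: (idemM e) => [x|e0|e1].
- by rewrite !eE f'K.
- left=> x; have := e0 (f' (x, 0)); rewrite eE f'K /= => /(congr1 f).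
  by rewrite f'K linear0 => -[].
right=> x; have := e1 (f' (0, x)); rewrite eE f'K /= => /(can_inj f'K).
by case.
Qed.

Lemma End_division_idem_trivial M : End_division M -> idem_trivial M.
Proof.
move=> [M0 divM]; split=> // e ee.
have [e0|e_neq0] := pselect (forall x, e x = 0); first by left.
have [e' [eK _]] := divM e e_neq0.
by right=> x; apply: (can_inj eK).
Qed.

(** A map [X -> Y] that is nonzero on [Y] is invertible there, so it would
    retract [X] onto [Y]. *)
Lemma nonsplit_End_division_eq0 Y X X' (f : {linear Y -> X})
    (g : {linear X -> X'}) (h : {linear X -> Y}) y :
  short_exact f g -> ~ split_epi g -> End_division Y -> h (f y) = 0.
Proof.
move=> fg nsplit [_ divY].
have [hf0|hf_neq0] := pselect (forall y, h (f y) = 0); first exact: hf0.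
have [u [hfK _]] := divY (h \o f)%FUN hf_neq0.
by case: nsplit; apply: (retraction_split (r := u \o h) fg).
Qed.

(** The behaviour of the projection from an iterated extension of [N] by copies
    of [Y], all of them non-split.  The last clause replaces a filtration of
    [ker p] by copies of [Y]: a nonzero map into [ker p] has a nonzero component
    in some factor of it.  In this form it passes to further extensions without
    any mention of the filtration. *)
Definition invisible_ker Y N M (p : {linear M -> N}) :=
  [/\ forall y, exists x, p x = y,
      forall (h : {linear M -> N}) x, p x = 0 -> h x = 0,
      forall (h : {linear M -> Y}) x, p x = 0 -> h x = 0
    & forall W (e : {linear W -> M}), (forall x, p (e x) = 0) ->
      (exists x, e x <> 0) -> exists2 h : {linear W -> Y},
      (exists x, h x <> 0) & forall x, e x = 0 -> h x = 0].

Lemma invisible_ker_id Y N : invisible_ker Y (idfun : {linear N -> N}).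
Proof.
split=> [y|h x /= ->|h x /= ->|W e /= e0 [x]]; rewrite ?linear0 ?e0 //.
by exists y.
Qed.

(** The hypothesis on maps [M' -> N] is left open because it has two sources:
    [Hom Y N = 0], or [N = Y] and the sequence does not split. *)
Lemma invisible_ker_comp Y N M M' (p : {linear M -> N})
    (f : {linear Y -> M'}) (g : {linear M' -> M}) :
  End_division Y -> short_exact f g -> ~ split_epi g ->
  (forall (h : {linear M' -> N}) y, h (f y) = 0) ->
  invisible_ker Y p -> invisible_ker Y (p \o g)%FUN.
Proof.
move=> divY fg nsplit fN [p_surj pN pY pW]; have [f_inj g_surj g_ker] := fg.
have lift C (h : {linear M' -> C}) : (forall y, h (f y) = 0) ->
    (forall (k : {linear M -> C}) x, p x = 0 -> k x = 0) ->
    forall x, (p \o g)%FUN x = 0 -> h x = 0.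
  move=> hf pC x /= pgx.
  have [|k kE] := lift_epi (h := h) g_surj; first by move=> z /g_ker[y <-].
  by rewrite -kE pC.
have Y_killed (h : {linear M' -> Y}) y : h (f y) = 0 :=
  nonsplit_End_division_eq0 h y fg nsplit divY.
split=> [y|h|h|W e pge [x ex]].
- by have [x <-] := p_surj y; have [z <-] := g_surj x; exists z.
- exact: lift.
- exact: lift.
- (* Either e is already visible in M, or it lands in the new copy of Y. *)
  have [ge0|ge_neq0] := pselect (forall x, g (e x) = 0).
    have [|h hE] := lift_mono (e := e) f_inj.
      by move=> z; apply/g_ker/ge0.
    exists h => [|z ez]; last by apply: f_inj; rewrite hE linear0.
    by exists x => hx; apply: ex; rewrite -hE hx linear0.
  have [|h h_neq0 hE] := pW W (g \o e)%FUN pge.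
    apply: contrapT => nex; apply: ge_neq0 => z; apply: contrapT => gez.
    by apply: nex; exists z.
  by exists h => // z ez; apply: hE; rewrite /= ez linear0.
Qed.

(** An idempotent [e] of [M] induces one of [N].  If that is zero, [e] maps into
    [ker p], and a nonzero map [h] to [Y] vanishing on [ker e] would satisfy
    [h = h e = 0]; if it is the identity, the same applies to [1 - e]. *)
Lemma invisible_ker_idem_trivial Y N M (p : {linear M -> N}) :
  invisible_ker Y p -> idem_trivial N -> idem_trivial M.
Proof.
move=> [p_surj pN pY pW] [N0 idemN]; split=> [M0|e ee].
  by apply: N0 => y; have [x <-] := p_surj y; rewrite (M0 x) linear0.
have idem_ker (d : {linear M -> M}) : (forall x, d (d x) = d x) ->
    (forall x, p (d x) = 0) -> forall x, d x = 0.
  move=> dd pd x; apply: contrapT => dx.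
  have [|h [z hz] hd] := pW M d pd; first by exists x.
  apply: hz; rewrite -[z](subrK (d z)) linearD /= hd ?pY // ?addr0 //.
  by rewrite linearB /= dd subrr.
have [|b bE] := lift_epi (h := p \o e)%FUN p_surj; first by move=> x; apply: pN.
have [y|b0|b1] := idemN b; first 1 last.
- by left; apply: idem_ker => // x; rewrite -[p _]bE b0.
- right=> x; apply/eqP; rewrite eq_sym -subr_eq0; apply/eqP.
  apply: (idem_ker (idfun \- e)%FUN) => z /=.
    by rewrite linearB /= ee subrr subr0.
  by rewrite linearB /= -[p (e z)]bE b1 subrr.
have [x <-] := p_surj y; by rewrite bE /= bE /= ee.
Qed.

End Idempotents.

(** * Finitely generated modules with a filtration *)

Section Filt.
Variable A : pzRingType.

Lemma zero_fgMod_exists : exists Z : fgMod A, is_zero Z.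
Proof.
have Z0 : is_zero (submod (zero_submod A^o)).
  by case=> z Oz; apply/val_inj/eqP.
have Zfg : fingen (submod (zero_submod A^o)).
  by exists 0%N, (fun=> 0) => z; exists (fun=> 0); rewrite big_ord0; apply: Z0.
by exists (FgMod Zfg).
Qed.

Lemma Filt_zero (C : fgMod A -> Prop) (Z : fgMod A) : is_zero Z -> Filt C Z.
Proof.
move=> Z0; exists 0%N, (fun=> zero_submod Z); split=> // x.
by rewrite (Z0 x) !inE eqxx.
Qed.

Lemma Filt_ext (C : fgMod A -> Prop) (Y X X' : fgMod A)
    (f : {linear Y -> X}) (g : {linear X -> X'}) :
  short_exact f g -> C Y -> Filt C X' -> Filt C X.
Proof.
move=> fg CY [n [V filV]]; exists n.+1.
apply: (filtration_ext fg filV) => [N NY|k N N' NN' [Z CZ N'Z]].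
  by exists Y.
by exists Z => //; apply: lmod_iso_trans N'Z.
Qed.

(** With [p = p' g], the kernels fit into [0 -> Y -> ker p -> ker p' -> 0]. *)
Lemma kernel_ext (C : fgMod A -> Prop) (Y X X' B : fgMod A)
    (f : {linear Y -> X}) (g : {linear X -> X'})
    (Z' : fgMod A) (i' : {linear Z' -> X'}) (p' : {linear X' -> B}) :
  short_exact f g -> C Y -> Filt C Z' -> short_exact i' p' ->
  exists (Z : fgMod A) (i : {linear Z -> X}) (p : {linear X -> B}),
    Filt C Z /\ short_exact i p.
Proof.
move=> fg CY FZ' i'p'; have [f_inj g_surj g_ker] := fg.
have [i'_inj p'_surj p'_ker] := i'p'.
pose p : {linear X -> B} := p' \o g.
pose K := preim_submod p (zero_submod B); pose i := @submod_val A X K.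
have KP x : reflect (p' (g x) = 0) (x \in K) by apply: eqP.
have gf y : g (f y) = 0 by apply/g_ker; exists y.
have [|a aE] := lift_mono (f := i) (e := f) (@submod_val_inj _ _ _).
  move=> y; have /KP Kfy : p' (g (f y)) = 0 by rewrite gf linear0.
  by exists (Submod Kfy).
have [|b bE] := lift_mono (f := i') (e := g \o i) i'_inj.
  by case=> x Kx; apply/p'_ker/KP.
have ab : short_exact a b.
  split=> [y y' ay|z|x].
  - by apply: f_inj; rewrite -!aE ay.
  - have [x gx] := g_surj (i' z).
    have /KP Kx : p' (g x) = 0 by rewrite gx; apply/p'_ker; exists z.
    by exists (Submod Kx); apply: i'_inj; rewrite bE.
  - split=> [bx|[y <-]].
      have := bE x; rewrite bx linear0 => /esym/g_ker[y fy].
      by exists y; apply: val_inj; rewrite /= [submod_val _]aE.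
    by apply: i'_inj; rewrite bE linear0 /= aE.
pose Z := FgMod (fingen_ext ab (fg_fingen Y) (fg_fingen Z')).
exists Z, i, p; split; first exact: (@Filt_ext C Y Z Z' a b ab CY FZ').
split=> [|z|x]; first exact: submod_val_inj.
- by have [x' <-] := p'_surj z; have [x <-] := g_surj x'; exists x.
split=> [/KP Kx|[[z Kz] <-]]; first by exists (Submod Kx).
exact/KP.
Qed.

Lemma Ext1_neq0_nonsplit (M C : fgMod A) : ~ Ext1_eq0 M C ->
  exists (E : fgMod A) (f : {linear C -> E}) (g : {linear E -> M}),
    short_exact f g /\ ~ split_epi g.
Proof.
move=> Ext_neq0; apply: contrapT => no_ext; apply: Ext_neq0.
apply/Ext1_eq0P => E f g fg; apply: contrapT => nsplit; apply: no_ext.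
by exists (FgMod (fingen_ext fg (fg_fingen C) (fg_fingen M))), f, g.
Qed.

End Filt.

(** * Towers *)

Section Towers.
Variables (A : pzRingType) (t : nat) (le : rel 'I_t) (Psi : 'I_t -> fgMod A).
Hypothesis pre : proper_pre_costratifying le Psi.

(** [tower i j n M]: [M] arises from [Psi i] by [n.-1] non-split extensions with
    left ends [Psi k] for a weakly decreasing sequence of indices [k].  Here [j]
    is only a lower bound for the last of them, so that the construction may
    pass to a smaller index without extending. *)
Inductive tower (i : 'I_t) : 'I_t -> nat -> fgMod A -> Prop :=
| tower_base : tower i i 1 (Psi i)
| tower_weaken k j n M : le k j -> tower i j n M -> tower i k n M
| tower_step j n (M M' : fgMod A)
    (f : {linear Psi j -> M'}) (g : {linear M' -> M}) :
    short_exact f g -> ~ split_epi g -> tower i j n M -> tower i j n.+1 M'.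

Lemma tower_le i j n M : tower i j n M -> le j i.
Proof.
have [[le_refl _ le_trans _] _ _ _] := pre.
by elim=> // {}j k {}n {}M kj _; apply: le_trans.
Qed.

Lemma tower_gt0 i j n M : tower i j n M -> (0 < n)%N.
Proof. by elim. Qed.

Lemma ordered_filtration_ext j (X X' : fgMod A) (f : {linear Psi j -> X})
    (g : {linear X -> X'}) n ord U :
  short_exact f g ->
  ordered_filtration le Psi n ord (U : nat -> submodClosed X') ->
  le j (ord 0%N) ->
  exists U', @ordered_filtration A t le Psi X n.+1
    (fun k => if k is k'.+1 then ord k' else j) U'.
Proof.
move=> fg [ord_le filU] j_ord.
have [||U' filU'] := filtration_ext (P' := fun k N => lmod_iso N
  (Psi (if k is k'.+1 then ord k' else j))) fg filU; first by [].
  by move=> k N N'; apply: lmod_iso_trans.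
by exists U'; split=> // -[|k] kn; last exact: ord_le.
Qed.

Lemma tower_filtration i j n M : tower i j n M ->
  exists ord U, @ordered_filtration A t le Psi M n ord U /\ le j (ord 0%N).
Proof.
have [[le_refl _ le_trans _] _ _ _] := pre.
elim=> [|k {}j {}n {}M kj _ [ord [U [ordU j_ord]]]
       |{}j {}n {}M M' f g fg _ _ [ord [U [ordU j_ord]]]].
- (* The one-step filtration is the empty one of 0 extended by Psi i. *)
  have [Z Z0] := zero_fgMod_exists A.
  have ex_id : short_exact (idfun : {linear Psi i -> Psi i})
      (\0%R : {linear Psi i -> Z}).
    split=> // [y|y]; first by exists 0; rewrite (Z0 y) (Z0 (_ 0)).
    by split=> // _; exists y.
  have [||U ordU] := ordered_filtration_ext (n := 0) (ord := fun=> i)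
    (U := fun=> zero_submod Z) ex_id.
  - by split=> //; split=> // x; rewrite (Z0 x) !inE eqxx.
  - exact: le_refl.
  by exists (fun k => if k is _.+1 then i else i), U.
- by exists ord, U; split=> //; apply: le_trans j_ord.
have [U' ordU'] := ordered_filtration_ext fg ordU j_ord.
by exists (fun k => if k is k'.+1 then ord k' else j), U'.
Qed.

Lemma tower_Fprime_n i j n M : tower i j n M -> Fprime_n le Psi n M.
Proof.
elim=> // [|{}j {}n {}M M' f g fg nsplit Mtower FM].
  by exists i; apply: lmod_iso_refl.
have n_gt0 := tower_gt0 Mtower.
have [ord [U [ordU j_ord]]] := tower_filtration Mtower.
have [U' ordU'] := ordered_filtration_ext fg ordU j_ord.
case: n n_gt0 FM ordU' {Mtower ordU} => // n _ FM ordU'; right.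
split; first by exists (fun k => if k is k'.+1 then ord k' else j), U'.
exists j, M, f, g; split=> //.
by exists n.+2, (fun k => if k is k'.+1 then ord k' else j), U'.
Qed.

Lemma tower_FiltPsi i j n M : tower i j n M -> FiltPsi Psi M.
Proof.
move=> /tower_filtration[ord [U [[_ [U0 Un U_inc U_Psi]] _]]].
exists n, U; split=> // k kn; exists (Psi (ord k)); last exact: U_Psi.
by exists (ord k).
Qed.

Lemma tower_kernel i j n M : tower i j n M ->
  exists (Z : fgMod A) (f : {linear Z -> M}) (g : {linear M -> Psi i}),
    Filt (fun Y => exists2 k, le k i & Y = Psi k) Z /\ short_exact f g.
Proof.
elim=> // [|{}j {}n {}M M' f g fg _ Mtower [Z [a [b [FZ ab]]]]]; last first.
  apply: (kernel_ext fg _ FZ ab).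
  by exists j => //; apply: tower_le Mtower.
have [Z Z0] := zero_fgMod_exists A.
exists Z, \0%R, idfun; split; first exact: Filt_zero.
split=> [x y _|y|y]; first by rewrite (Z0 x) (Z0 y).
  by exists y.
by split=> [/= ->|[_ <-]] //; exists 0.
Qed.

(** Ensures, when the construction moves on to [d], that maps into the tower
    reached so far vanish on the copies of [Psi d] put below it. *)
Lemma tower_Hom_eq0 i j n M d : tower i j n M -> idx_lt le d j ->
  Hom_eq0 (Psi d) M.
Proof.
have [[le_refl le_anti le_trans _] _ Hom0 _] := pre.
elim=> [|k {}j {}n {}M kj _ IHM|{}j {}n {}M M' f g fg _ _ IHM] dj.
- exact: Hom0.
- move: dj => /andP[dk le_dk]; apply: IHM.
  rewrite /idx_lt (le_trans _ _ _ le_dk kj) andbT.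
  apply: contraNneq dk => dj; rewrite -dj in kj.
  by rewrite (le_anti d k) // le_dk.
have [f_inj _ g_ker] := fg => h x.
have /g_ker[y fy] : g (h x) = 0 := IHM dj (g \o h)%FUN x.
have [|h' h'E] := lift_mono (e := h) f_inj.
  by move=> z; apply/g_ker/(IHM dj (g \o h)%FUN).
by rewrite -h'E (Hom0 _ _ dj h') linear0.
Qed.

Hypothesis bounded : bounded_ind_length Psi.

Lemma tower_bounded : exists b, forall i j n M,
  tower i j n M -> idem_trivial M -> (n <= b)%N.
Proof.
have [b bP] := bounded; have [_ Psi_div _ _] := pre.
exists b => i j n M Mtower idemM.
have [l Ml lb] :=
  bP M (tower_FiltPsi Mtower) (idem_trivial_indecomposable idemM).
apply: leq_trans lb; have [ord [U [[_ filU] _]]] := tower_filtration Mtower.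
apply: (filtration_le_length Ml filU) => k N [f [f' fK f'K]] N0.
have [Psi0 _] := Psi_div (ord k).
by apply: Psi0 => x; rewrite -[x]f'K (N0 (f' x)) linear0.
Qed.

(** The state of the construction once the indices down to [j] are exhausted. *)
Definition Ext_stage (i j : 'I_t) (M : fgMod A) :=
  [/\ exists n, tower i j n M, idem_trivial M
    & forall k, le j k -> Ext1_eq0 M (Psi k)].

(** Exhausting one index.  The induction is on [s], the number of steps left
    before the tower would exceed the bound [b] on its height. *)
Lemma Ext_stage_exists i j n (N : fgMod A) : tower i j n N -> idem_trivial N ->
  Hom_eq0 (Psi j) N \/ N = Psi j ->
  (forall k, idx_lt le j k -> Ext1_eq0 N (Psi k)) ->
  exists M, Ext_stage i j M.
Proof.
have [b bP] := tower_bounded; have [_ Psi_div _ Ext0] := pre.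
move=> Ntower idemN HomN ExtN.
suff phase s m (M : fgMod A) (p : {linear M -> N}) :
    (b < m + s)%N -> tower i j m M -> invisible_ker (Psi j) p ->
    (forall k, idx_lt le j k -> Ext1_eq0 M (Psi k)) ->
    exists M, Ext_stage i j M.
  apply: (phase b.+1 n N idfun) => //; last exact: invisible_ker_id.
  by rewrite addnS ltnS leq_addl.
elim: s m M p => [|s IHs] m M p b_lt Mtower pM ExtM.
  have := bP _ _ _ _ Mtower (invisible_ker_idem_trivial pM idemN).
  by rewrite leqNgt -[m]addn0 b_lt.
have [Extj|/Ext1_neq0_nonsplit[M' [f [g [fg nsplit]]]]] :=
    pselect (Ext1_eq0 M (Psi j)).
  exists M; split=> [||k jk]; first by exists m.
    exact: invisible_ker_idem_trivial pM idemN.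
  by have [<- // | j_neq_k] := eqVneq j k; apply: ExtM; rewrite /idx_lt j_neq_k.
apply: (IHs m.+1 M' (p \o g)%FUN); first by rewrite addSnnS.
- exact: tower_step fg nsplit Mtower.
- apply: (invisible_ker_comp (Psi_div j) fg nsplit _ pM) => h y.
  case: HomN => [HomN|N_Psi]; first exact: (HomN (h \o f)%FUN).
  by subst N; apply: nonsplit_End_division_eq0 fg nsplit (Psi_div j).
by move=> k jk; apply: Ext1_eq0_ext fg (ExtM k jk) (Ext0 j k jk).
Qed.

(** The predecessor of [j]: among the smaller indices, the one with the most
    elements below it. *)
Lemma pred_exists j : (exists d, idx_lt le d j) ->
  exists2 m, idx_lt le m j & forall k, idx_lt le m k -> le j k.
Proof.
have [[le_refl le_anti le_trans le_total] _ _ _] := pre.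
move=> [d dj].
have [m mj m_max] := @arg_maxnP _ d (idx_lt le ^~ j)
  (fun m => #|[set l | le l m]|) dj.
exists m => // k mk; have [//|le_kj] : le j k \/ le k j.
  by apply/orP; apply: le_total.
have [<- // |k_neq_j] := eqVneq k j.
have /m_max : idx_lt le k j by rewrite /idx_lt k_neq_j.
rewrite /= leqNgt => /negP[]; apply: proper_card; rewrite properE.
move: mk => /andP[m_neq_k mk]; apply/andP; split.
  by apply/subsetP => l; rewrite !inE => lm; apply: le_trans mk.
apply/negP => /subsetP/(_ k); rewrite !inE => /(_ (le_refl k)) km.
by move: m_neq_k; rewrite (le_anti m k) ?eqxx // mk.
Qed.

(** After the stage at [j], the vanishing of [Ext1] is known for the
    indices above the predecessor of [j], which is what the next stage requires;
    hence the induction on the number of indices below [j]. *)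
Lemma costratifying_tower i : exists M n j,
  [/\ tower i j n M, idem_trivial M & forall k, Ext1_eq0 M (Psi k)].
Proof.
have [[le_refl le_anti le_trans le_total] Psi_div _ Ext0] := pre.
have [M stageM] : exists M, Ext_stage i i M.
  apply: (Ext_stage_exists (N := Psi i)); [exact: tower_base | | by right | ].
    exact: End_division_idem_trivial.
  by move=> k; apply: Ext0.
have [m] := ubnP #|[set d | idx_lt le d i]|.
move: {2 3}i M stageM; elim: m => // m IHm j M [[n Mtower] idemM ExtM] jm.
have [/pred_exists[k kj k_max]|no_pred] := pselect (exists d, idx_lt le d j).
  have [le_kj k_neq_j] : le k j /\ k != j by case/andP: kj.
  have [M' stageM'] : exists M', Ext_stage i k M'.
    apply: (Ext_stage_exists (tower_weaken le_kj Mtower) idemM).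
      by left; apply: tower_Hom_eq0 Mtower kj.
    by move=> l /k_max; apply: ExtM.
  apply: (IHm k M' stageM'); apply: leq_trans (proper_card _) jm.
  rewrite properE; apply/andP; split.
    apply/subsetP => l; rewrite !inE => /andP[l_neq_k lk].
    rewrite /idx_lt (le_trans _ _ _ lk le_kj) andbT.
    apply: contraNneq l_neq_k => lj; rewrite lj in lk *.
    by rewrite (le_anti j k) // lk.
  apply/negP => /subsetP/(_ k); rewrite !inE => /(_ kj).
  by rewrite /idx_lt eqxx.
exists M, n, j; split=> // k; apply: ExtM.
have [// | le_kj] : le j k \/ le k j by apply/orP; apply: le_total.
have [<- // | k_neq_j] := eqVneq k j.
by case: no_pred; exists k; rewrite /idx_lt k_neq_j.
Qed.

End Towers.

Theorem theorem3p11 (R : comPzRingType) (A : algType R) (t : nat)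
    (le : rel 'I_t) (Psi : 'I_t -> fgMod A) :
  artin_algebra A ->
  proper_pre_costratifying le Psi ->
  bounded_ind_length Psi ->
  exists Q : 'I_t -> fgMod A,
    (forall i, Fprime le Psi (Q i)) /\ proper_costratifying le Psi Q.
Proof.
move=> _ pre bounded.
have [Q QP] := choice (costratifying_tower pre bounded).
have [le_lin Psi_div Hom0 _] := pre.
exists Q; split=> [i|].
  have [n [j [Qtower _ _]]] := QP i.
  by exists n; [exact: tower_gt0 Qtower | exact: tower_Fprime_n Qtower].
split=> // [|i|i k].
- split=> // i; have [n [j [_ idemQ _]]] := QP i.
  exact: idem_trivial_indecomposable.
- by have [n [j [Qtower _ _]]] := QP i; apply: tower_kernel Qtower.
- by have [n [j [_ _ ExtQ]]] := QP i; apply: ExtQ.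
Qed.
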